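(* For every $\epsilon > 0$ there exist a positive integer $S$ and parallelograms $P_s = P_{b_1^s, b_2^s, \delta^s}$, $s = 1, \dots, S$ (with $\delta^s > 0$ and $0 \le b_1^s, b_2^s \le 1 - \delta^s$), such that (i) $\bigcup_{s=1}^{S} I_{b_1^s, \delta^s} \supset \{0\} \times [\epsilon, 1-\epsilon]$; and such that for any $x_0, y_0 \in [0,1]$ and for $J = [0,x_0]\times[0,1]$ or $J = [0,1]\times[0,y_0]$ the following hold: (ii) $\left| \lambda^2\left( \bigcup_{s=1}^{S} P_s \cap J \right) - \frac{3}{4} \lambda^2(J) \right| < \epsilon$; (iii) $\left| \sum_{s=1}^{S} \lambda^2(P_s \cap J) - \lambda^2(J) \right| < \epsilon$.
   Context: $\lambda^2$ denotes two-dimensional Lebesgue measure on $\mathbb{R}^2$. For $\delta > 0$ and $0 \le b_1, b_2 \le 1-\delta$, the parallelogram $P_{b_1,b_2,\delta}$ is the convex hull $$P_{b_1,b_2,\delta} := \operatorname{conv}\{(0,b_1),(0,b_1+\delta),(1,b_2),(1,b_2+\delta)\} \subset [0,1]\times[0,1].$$ For $\delta > 0$ and $0 \le b \le 1-\delta$, put $I_{b,\delta} = \{0\}\times[b,b+\delta]$; thus $I_{b_1,\delta}$ is the left side of $P_{b_1,b_2,\delta}$. By convention $[\epsilon,1-\epsilon]$ is empty if $\epsilon > 1-\epsilon$. *)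

(* Defs.v *)
From HB Require Import structures.
From mathcomp Require Import all_boot all_order all_algebra.
From mathcomp Require Import all_classical all_reals all_analysis.

Set Implicit Arguments.
Unset Strict Implicit.
Unset Printing Implicit Defensive.

Import Order.TTheory GRing.Theory Num.Theory.

Local Open Scope classical_set_scope.
Local Open Scope ring_scope.

Definition convex_hull (R : numDomainType) (M : lmodType R) (A : set M) : set M :=
  smallest (@convex_set R M) A.

(* [R^o] is needed for the vector-space structure of the plane; [R^o * R^o] is
   convertible to [R * R]. *)
Definition parallelogram (R : realType) (b1 b2 delta : R) : set (R * R) :=
  @convex_hull R (R^o * R^o)%type
    [set (0, b1); (0, b1 + delta); (1, b2); (1, b2 + delta)].

Definition left_side (R : realType) (b delta : R) : set (R * R) :=
  [set 0] `*` `[b, b + delta].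

Definition lebesgue_measure2 (R : realType) : set (R * R) -> \bar R :=
  (@lebesgue_measure R \x @lebesgue_measure R)%E.

(* Main.v *)
Require Import Defs.
From HB Require Import structures.
From mathcomp Require Import all_boot all_order all_algebra.
From mathcomp Require Import all_classical all_reals all_analysis.
From mathcomp Require Import measurable_realfun ring lra.

(** Let [p = 1 / (n + 1)] be small and cut the left side into [1 / p ^ 2] cells
of length [p ^ 2].  The lower half of every cell starts a horizontal
parallelogram (the set [flats]); the upper half of every cell, except for those
within [p] of the top, starts a parallelogram of slope [p] (the set [tilteds]).
The left sides then cover [0, 1 - p].

Each of the two families is disjoint and fills half of the square, so the sum
of the measures on [J] is nearly the measure of [J].  The families behave as if
they were independent: although the slope [p] is small, a tilted parallelogram
still rises by [1 / p] cells in total, so a horizontal line at height [y] meets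
the tilted family in a comb of intervals of length [p / 2] with period [p], and
the part of that comb in [0, x0] has length close to [x0 / 2].  This holds for
every [y] at distance at least [p] from the top and from the bottom, hence the
tilted family fills nearly half of [0, x0] x Y for every measurable set [Y] of
heights ([lebesgue_measure2_tilteds]).  With [Y = [0, y0]] this gives the
measure of the tilted family in J = [0, x0] x [0, y0]; with [Y] the set of
heights of the flat family in [0, y0] it gives the measure of the intersection
of the families, which is close to a quarter of that of [J].  By
inclusion-exclusion the union fills 1/2 + 1/2 - 1/4 = 3/4 of [J].

The measure of a set in the plane is estimated through its horizontal sections:
a set whose sections are no longer than those of a rectangle has measure at
most that of the rectangle ([le_lebesgue_measure2_ysection]). *)

Set Implicit Arguments.
Unset Strict Implicit.
Unset Printing Implicit Defensive.

Import Order.TTheory GRing.Theory Num.Theory.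

Local Open Scope classical_set_scope.
Local Open Scope ring_scope.

(** * Periodic unions of intervals on the line *)

Section Combs.
Variable R : realType.
Implicit Types (o p a b c d z : R) (K : nat).

(** The length of the part of [[c, d]] below [z]; the number of teeth of a comb
that meet a window then never has to be counted, as the length of the comb in
[[a, b]] is a difference of two sums of ramps. *)
Definition ramp c d z := Num.min (Num.max z c) d - c.

Lemma rampP c d z : c <= d ->
  [\/ z <= c /\ ramp c d z = 0, c <= z <= d /\ ramp c d z = z - c
    | d <= z /\ ramp c d z = d - c].
Proof.
move=> cd; rewrite /ramp.
have [zc|/ltW cz] := leP z c.
  by rewrite min_l //; constructor 1; rewrite subrr.
by have [zd|/ltW dz] := leP z d; [constructor 2; rewrite cz | constructor 3].
Qed.

Lemma lebesgue_measure_segment a b : a <= b ->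
  lebesgue_measure (`[a, b] : set R) = (b - a)%:E.
Proof.
rewrite lebesgue_measure_itv /= lte_fin => ab; case: ltP => // ba.
have -> : a = b by lra.
by rewrite subrr.
Qed.

Lemma lebesgue_measure_itvI c d a b : c <= d -> a <= b ->
  lebesgue_measure (`[c, d] `&` `[a, b] : set R) = (ramp c d b - ramp c d a)%:E.
Proof.
move=> cd ab.
have -> : `[c, d] `&` `[a, b] = `[Num.max c a, Num.min d b]%classic.
  by apply/seteqP; split=> z /=; rewrite !in_itv/= ge_max le_min;
    [case=> /andP[-> ->] /andP[-> ->] | case/andP=> /andP[-> ->] /andP[-> ->]].
rewrite lebesgue_measure_itv /= lte_fin -EFinB.
have [?|?] := leP c a; have [?|?] := leP d b;
  case: (rampP b cd) => -[? ->]; case: (rampP a cd) => -[? ->];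
  case: ltP => ?; congr _%:E; lra.
Qed.

Definition comb o p K : set R :=
  \bigcup_(k < K) `[o + k%:R * p, o + k%:R * p + p / 2]%classic.

Definition comb_ramp o p K z :=
  \sum_(k < K) ramp (o + k%:R * p) (o + k%:R * p + p / 2) z.

Lemma comb0 o p : comb o p 0 = set0.
Proof. by rewrite /comb bigcup_mkord big_ord0. Qed.

Lemma combS o p K :
  comb o p K.+1 = comb o p K `|` `[o + K%:R * p, o + K%:R * p + p / 2]%classic.
Proof. by rewrite /comb !bigcup_mkord big_ord_recr. Qed.

Lemma measurable_comb o p K : measurable (comb o p K).
Proof.
by rewrite /comb bigcup_mkord; apply: bigsetU_measurable => k _.
Qed.

Lemma comb_bounds o p K z : 0 < p -> comb o p K z ->
  o <= z <= o + K%:R * p - p / 2.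
Proof.
move=> p0 [k /= kK]; rewrite in_itv /=.
have : 0 <= k%:R * p by rewrite mulr_ge0 // ltW.
have : k.+1%:R * p <= K%:R * p by rewrite ler_pM2r // ler_nat.
by rewrite -natr1 mulrDl mul1r; lra.
Qed.

Lemma comb_measureE o p K a b : 0 < p -> a <= b ->
  lebesgue_measure (comb o p K `&` `[a, b]) =
  (comb_ramp o p K b - comb_ramp o p K a)%:E.
Proof.
move=> p0 ab; elim: K => [|K IH].
  by rewrite comb0 set0I measure0 /comb_ramp !big_ord0 subrr.
have gap (z : R) : o <= z <= o + K%:R * p - p / 2 ->
    `[o + K%:R * p, o + K%:R * p + p / 2]%classic z -> False.
  by rewrite /= in_itv /=; lra.
rewrite combS setIUl measureU.
- rewrite [X in (X + _)%E]IH [X in (_ + X)%E]lebesgue_measure_itvI //;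
    last by lra.
  by rewrite -EFinD /comb_ramp !big_ord_recr /=; congr _%:E; ring.
- by apply: measurableI => //; exact: measurable_comb.
- exact: measurableI.
- rewrite -subset0 => z [] [/(comb_bounds p0) + _] [+ _].
  exact: gap.
Qed.

Lemma comb_ramp_full o p K z : 0 < p -> o + K%:R * p - p / 2 <= z ->
  comb_ramp o p K z = K%:R * p / 2.
Proof.
move=> p0; elim: K => [|K IH] zK; first by rewrite /comb_ramp big_ord0 !mul0r.
have E : K.+1%:R * p = K%:R * p + p by rewrite -natr1 mulrDl mul1r.
rewrite /comb_ramp big_ord_recr /= -/(comb_ramp o p K z) IH; last by lra.
have q2 : o + K%:R * p <= o + K%:R * p + p / 2 by lra.
by case: (rampP z q2) => -[? ->]; lra.
Qed.

(** Along each period the comb gains [p / 2], as does half of the ramp of the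
whole window; within a period the comb, whose tooth comes first, is ahead by at
most [p / 4]. *)
Lemma comb_ramp_bounds o p K z : 0 < p ->
  ramp o (o + K%:R * p) z / 2 <= comb_ramp o p K z
     <= ramp o (o + K%:R * p) z / 2 + p / 4.
Proof.
move=> p0; elim: K => [|K IH].
  rewrite /comb_ramp big_ord0 mul0r addr0.
  by case: (rampP z (lexx o)) => -[? ->]; lra.
have Kp0 : 0 <= K%:R * p by rewrite mulr_ge0 // ltW.
have full : o + K%:R * p <= z -> comb_ramp o p K z = K%:R * p / 2.
  by move=> zK; apply: comb_ramp_full => //; lra.
have E : K.+1%:R * p = K%:R * p + p by rewrite -natr1 mulrDl mul1r.
have q1 : o <= o + K%:R * p by lra.
have q2 : o + K%:R * p <= o + K%:R * p + p / 2 by lra.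
have q3 : o <= o + K.+1%:R * p by lra.
rewrite /comb_ramp big_ord_recr /= -/(comb_ramp o p K z).
move: IH; case: (rampP z q3) => -[? ->]; case: (rampP z q2) => -[? ->];
  case: (rampP z q1) => -[? ->] IH; try (by lra); by rewrite full; lra.
Qed.

(** A comb has density one half, up to a boundary error which does not depend on
the window.  The upper bound holds for every window; the lower one needs the
window to lie in the range of the comb. *)
Lemma comb_measure_bounds o p K a b : 0 < p -> a <= b ->
  exists v, [/\ lebesgue_measure (comb o p K `&` `[a, b]) = v%:E,
    v <= (b - a) / 2 + p / 4
    & o <= a -> b <= o + K%:R * p -> (b - a) / 2 - p / 4 <= v].
Proof.
move=> p0 ab; exists (comb_ramp o p K b - comb_ramp o p K a).
have oK : o <= o + K%:R * p by rewrite lerDl mulr_ge0 // ltW.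
split; first exact: comb_measureE.
  move: (comb_ramp_bounds o K b p0) (comb_ramp_bounds o K a p0).
  by case: (rampP a oK) => -[? ->]; case: (rampP b oK) => -[? ->]; lra.
move=> oa bK.
move: (comb_ramp_bounds o K b p0) (comb_ramp_bounds o K a p0).
by case: (rampP a oK) => -[? ->]; case: (rampP b oK) => -[? ->]; lra.
Qed.
End Combs.

(** * Parallelograms and measure in the plane *)

Section Plane.
Variable R : realType.
Implicit Types (b d s x y : R).

Definition strip b s d : set (R * R) :=
  [set z | 0 <= z.1 <= 1 /\ b + s * z.1 <= z.2 <= b + s * z.1 + d].

Lemma convex_strip b s d : @convex_set R (R^o * R^o)%type (strip b s d).
Proof.
move=> u v t; rewrite !inE => -[/= u1 u2] [v1 v2].
rewrite -[conv t u v]/(t%:num * u.1 + (1 - t%:num) * v.1,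
                       t%:num * u.2 + (1 - t%:num) * v.2) /strip /=.
have t0 : 0 <= t%:num :> R by [].
have t1 : t%:num <= 1 :> R by [].
move: (t%:num) t0 t1 => {}t t0 t1.
split; nra.
Qed.

(** A point of the strip at relative height [r] above the lower edge lies on the
segment that joins the points of the two vertical sides at relative height [r],
and each of these is a convex combination of two vertices. *)
Lemma parallelogramE b1 b2 d : 0 < d ->
  parallelogram b1 b2 d = strip b1 (b2 - b1) d.
Proof.
move=> d0; apply/seteqP; split.
  apply: smallest_sub; first exact: convex_strip.
  by move=> z [[[]|]|] -> /=; rewrite /strip /=; lra.
move=> [x y] [/= /andP[x0 x1] yb] C [cC HC].
pose r := (y - (b1 + (b2 - b1) * x)) / d.
have r0 : 0 <= r by rewrite /r divr_ge0 //; lra.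
have r1 : r <= 1 by rewrite /r ler_pdivrMr //; lra.
have rE : r * d = y - (b1 + (b2 - b1) * x) by rewrite /r divfK // gt_eqF.
have Cl : C (0, b1 + r * d).
  have := cC (0, b1 + d) (0, b1) (Itv01 r0 r1).
  rewrite !inE => /(_ (HC _ _) (HC _ _)); rewrite /=.
  rewrite -[conv _ _ _]/(r * 0 + (1 - r) * 0, r * (b1 + d) + (1 - r) * b1).
  have -> : r * 0 + (1 - r) * 0 = 0 :> R by ring.
  have -> : r * (b1 + d) + (1 - r) * b1 = b1 + r * d by ring.
  by apply; tauto.
have Cr : C (1, b2 + r * d).
  have := cC (1, b2 + d) (1, b2) (Itv01 r0 r1).
  rewrite !inE => /(_ (HC _ _) (HC _ _)); rewrite /=.
  rewrite -[conv _ _ _]/(r * 1 + (1 - r) * 1, r * (b2 + d) + (1 - r) * b2).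
  have -> : r * 1 + (1 - r) * 1 = 1 :> R by ring.
  have -> : r * (b2 + d) + (1 - r) * b2 = b2 + r * d by ring.
  by apply; tauto.
have := cC _ _ (Itv01 x0 x1) (mem_set Cr) (mem_set Cl); rewrite inE.
rewrite -[conv _ _ _]/(x * 1 + (1 - x) * 0,
                       x * (b2 + r * d) + (1 - x) * (b1 + r * d)).
have -> : x * 1 + (1 - x) * 0 = x by ring.
by have -> : x * (b2 + r * d) + (1 - x) * (b1 + r * d) = y by lra.
Qed.

Lemma measurable_strip b s d : measurable (strip b s d).
Proof.
have -> : strip b s d = (fst @^-1` `[0, 1]) `&`
   ((fun z : R * R => z.2 - s * z.1) @^-1` `[b, b + d]).
  by apply/seteqP; split=> z; rewrite /strip /= !in_itv /=; lra.
apply: measurableI; rewrite -[X in measurable X]setTI.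
  exact: measurable_fst.
suff : measurable_fun setT (fun z : R * R => z.2 - s * z.1) by apply.
apply: measurable_funB; first exact: measurable_snd.
apply: measurable_funM => //; exact: measurable_fst.
Qed.

Local Notation lam := (@lebesgue_measure R).
Local Notation lam2 := (@lebesgue_measure2 R).

(** The product measure is defined by vertical sections; by uniqueness of the
product measure it is also computed by horizontal ones. *)
Lemma lebesgue_measure2_ysection S : measurable S ->
  lam2 S = (\int[lam]_y lam (ysection S y))%E.
Proof.
move=> mS; rewrite /lebesgue_measure2.
rewrite (@product_measure_unique _ _ _ _ _ lam lam
  (product_measure2 lam lam)) //.
by move=> A B mA mB; exact: product_measure2E.
Qed.

(** Cavalieri's principle. *)
Lemma le_lebesgue_measure2_ysection S S' : measurable S -> measurable S' ->
  (forall y, lam (ysection S y) <= lam (ysection S' y))%E ->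
  (lam2 S <= lam2 S')%E.
Proof.
move=> mS mS' SS'; rewrite !lebesgue_measure2_ysection //.
apply: ge0_le_integral => //.
- exact: measurable_fun_ysection.
- exact: measurable_fun_ysection.
Qed.

Lemma trivIset_strips N (b : nat -> R) s d :
  (forall j k, (j < k)%N -> b j + d < b k \/ b k + d < b j) ->
  trivIset [set: 'I_N] (fun k : 'I_N => strip (b k) s d).
Proof.
move=> sep; apply/trivIsetP => j k _ _ jk.
rewrite -subset0 => -[x y] /= [[_ /= jy] [_ /= ky]].
by move: jk; rewrite -val_eqE /= neq_ltn => /orP[] /sep[]; lra.
Qed.

Lemma lebesgue_measure2_setX (X Y : set R) : measurable X -> measurable Y ->
  (lam2 (X `*` Y) = lam X * lam Y)%E.
Proof. by move=> mX mY; rewrite /lebesgue_measure2 product_measure1E. Qed.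

Lemma lebesgue_measure2_bigcup_setI n (F : 'I_n -> set (R * R)) J :
  (forall k, measurable (F k)) -> trivIset setT F -> measurable J ->
  lam2 (\bigcup_k F k `&` J) = (\sum_(k < n) lam2 (F k `&` J))%E.
Proof.
move=> mF tF mJ.
rewrite setI_bigcupl /lebesgue_measure2.
have -> : \bigcup_k (F k `&` J) = \big[setU/set0]_(k < n) (F k `&` J).
  by rewrite -bigcup_pred; apply: eq_bigcupl; split => k.
rewrite measure_bigsetU_ord //; last exact: trivIset_setIr.
by move=> k; exact: (measurableI _ _ (mF k) mJ).
Qed.

End Plane.

(** * The flat and the tilted family *)

Lemma natrSM (R : pzRingType) (k : nat) (r : R) : k.+1%:R * r = k%:R * r + r.
Proof. by rewrite -natr1 mulrDl mul1r. Qed.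

Lemma ereal_between (R : realType) (x : \bar R) (l u : R) :
  (l%:E <= x <= u%:E)%E -> exists2 v, x = v%:E & l <= v <= u.
Proof.
by case: x => [r||] /andP[]; rewrite ?lee_fin ?leye_eq ?leeNy_eq // => lr ru;
  exists r => //; rewrite lr.
Qed.

Section Families.
Variables (R : realType) (n : nat).
Implicit Types (x y : R).
Local Notation lam := (@lebesgue_measure R).
Local Notation lam2 := (@lebesgue_measure2 R).

Definition mesh : R := n.+1%:R^-1.
Local Notation p := mesh.

Lemma mesh_gt0 : 0 < p. Proof. by rewrite invr_gt0 ltr0n. Qed.

Lemma mesh_mul : n.+1%:R * p = 1. Proof. by rewrite divff // pnatr_eq0. Qed.

Lemma mesh_muln : n%:R * p = 1 - p.
Proof. by have := mesh_mul; rewrite natrSM => /(canRL (addrK _)). Qed.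

Lemma mesh_le1 : p <= 1.
Proof. by rewrite invf_le1 ?ler1n ?ltr0n. Qed.

Definition flat (k : nat) : set (R * R) := strip (k%:R * p ^+ 2) 0 (p ^+ 2 / 2).

(** The tilted strips are numbered downwards: along a horizontal line they are
then met from left to right, so that [comb] describes the section with
increasing offsets.  The right side of the topmost one ends at height 1. *)
Definition tilted (k : nat) : set (R * R) :=
  strip ((n.+1 * n)%:R * p ^+ 2 - k%:R * p ^+ 2 - p ^+ 2 / 2) p (p ^+ 2 / 2).

Definition flats := \bigcup_(k : 'I_(n.+1 * n.+1)) flat k.
Definition tilteds := \bigcup_(k : 'I_(n.+1 * n)) tilted k.

Lemma flats_setI (x0 y0 : R) : x0 <= 1 ->
  flats `&` (`[0, x0] `*` `[0, y0]) =
  `[0, x0] `*` (comb 0 (p ^+ 2) (n.+1 * n.+1) `&` `[0, y0]).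
Proof.
move=> x01; apply/seteqP; split=> -[x y] /=; rewrite !in_itv /=.
  case=> -[k _ [_ /= kx]] [x0x y0y]; split=> //; split=> //.
  by exists k => //=; rewrite in_itv /=; lra.
case=> x0x [[k /= kN]]; rewrite in_itv /= => kx y0y; split=> //.
by exists (Ordinal kN) => //; split=> /=; lra.
Qed.

(** Moving right by [p] along a horizontal line lowers it by one cell, of height
[p ^ 2], relative to a strip of slope [p]. *)
Lemma ysection_tilteds (x0 y : R) (Y : set R) : x0 <= 1 ->
  ysection (tilteds `&` (`[0, x0] `*` Y)) y =
  if y \in Y then comb ((y - 1) / p + 1) p (n.+1 * n) `&` `[0, x0] else set0.
Proof.
have p0 := mesh_gt0; have pn := mesh_muln.
move=> x01; case: ifPn; rewrite ?inE ?notin_setE => Yy; last first.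
  by apply/seteqP; split=> // x /ysectionP[_ []].
have E k x : (y - 1) / p + 1 + k * p <= x <= (y - 1) / p + 1 + k * p + p / 2
    <-> y - 1 + p + k * p ^+ 2 <= x * p <= y - 1 + p + k * p ^+ 2 + p ^+ 2 / 2.
  have yE : (y - 1) / p * p = y - 1 by rewrite divfK // gt_eqF.
  split=> /andP[l u]; apply/andP; split.
  - by have := ler_wpM2r (ltW p0) l; lra.
  - by have := ler_wpM2r (ltW p0) u; lra.
  - by rewrite -(ler_pM2r p0); lra.
  - by rewrite -(ler_pM2r p0); lra.
have NK : (n.+1 * n)%:R * p ^+ 2 = 1 - p.
  by rewrite natrM expr2 mulrACA mesh_mul mul1r.
apply/seteqP; split=> [x /ysectionP[[k _ [_]]] |x [[k /= kK]]].
  rewrite /= NK => kx [x0x _]; split=> //; exists k => //=.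
  by rewrite in_itv /=; apply/E; lra.
rewrite in_itv /= => /E kx x0x; apply/ysectionP; split=> //.
exists (Ordinal kK) => //; split; rewrite /= ?NK; last by lra.
by move: x0x; rewrite /= in_itv /=; lra.
Qed.

Lemma measurable_flats : measurable flats.
Proof. by apply: fin_bigcup_measurable => // k _; exact: measurable_strip. Qed.

Lemma measurable_tilteds : measurable tilteds.
Proof. by apply: fin_bigcup_measurable => // k _; exact: measurable_strip. Qed.

Lemma mesh_step (a b : nat) : (a < b)%N ->
  a%:R * p ^+ 2 + p ^+ 2 <= b%:R * p ^+ 2.
Proof.
by move=> ab; rewrite -natrSM ler_pM2r ?ler_nat // exprn_gt0 // mesh_gt0.
Qed.

Lemma trivIset_flat N : trivIset [set: 'I_N] (fun k : 'I_N => flat k).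
Proof.
apply: (@trivIset_strips R N (fun k : nat => k%:R * p ^+ 2)).
move=> j k /mesh_step jk; left.
by have := exprn_gt0 2 mesh_gt0; lra.
Qed.

Lemma trivIset_tilted N : trivIset [set: 'I_N] (fun k : 'I_N => tilted k).
Proof.
apply: (@trivIset_strips R N (fun k : nat =>
  (n.+1 * n)%:R * p ^+ 2 - k%:R * p ^+ 2 - p ^+ 2 / 2)).
move=> j k /mesh_step jk; right.
by have := exprn_gt0 2 mesh_gt0; lra.
Qed.

Lemma lebesgue_measure2_flats (x0 y0 : R) : 0 <= x0 <= 1 -> 0 <= y0 <= 1 ->
  exists v, [/\ lam (comb 0 (p ^+ 2) (n.+1 * n.+1) `&` `[0, y0]) = v%:E,
   lam2 (flats `&` (`[0, x0] `*` `[0, y0])) = (x0 * v)%:E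
   & `|v - y0 / 2| <= p / 4].
Proof.
move=> /andP[x0p x0l] /andP[y0p y0l].
have p0 := mesh_gt0; have p1 := mesh_le1.
have pp0 : 0 < p ^+ 2 by rewrite exprn_gt0.
have [v [vE vu vl]] := comb_measure_bounds 0 (n.+1 * n.+1) pp0 y0p.
exists v; split=> //.
  rewrite flats_setI // lebesgue_measure2_setX //; last first.
    by apply: measurableI => //; exact: measurable_comb.
  by rewrite vE lebesgue_measure_segment // subr0 -EFinM.
have NN : (n.+1 * n.+1)%:R * p ^+ 2 = 1.
  by rewrite natrM expr2 mulrACA mesh_mul mul1r.
have := vl (lexx 0); rewrite NN add0r => /(_ y0l) vl'.
have : p ^+ 2 <= p by rewrite expr2; nra.
by rewrite ler_norml; lra.
Qed.

(** Heights within [p] of the top or bottom, where the section of the tilted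
family may be incomplete, cost at most [2 * p]. *)
Lemma lebesgue_measure_inner (Y : set R) v : measurable Y ->
  Y `<=` `[0, 1] -> lam Y = v%:E ->
  exists2 w, lam (Y `&` `[p, 1 - p]) = w%:E & v - 2 * p <= w <= v.
Proof.
move=> mY Y01 vE; have p0 := mesh_gt0; have p1 := mesh_le1.
have mYI : measurable (Y `&` `[p, 1 - p]) by apply: measurableI.
apply: ereal_between; apply/andP; split; last first.
  by rewrite -vE; apply: le_measure; rewrite ?inE //; exact: subIsetl.
rewrite EFinB leeBlDr // -vE.
apply: (@le_trans _ _
  (lam ((Y `&` `[p, 1 - p]) `|` (`[0, p] `|` `[1 - p, 1])))).
  apply: le_measure; rewrite ?inE //; first by do !apply: measurableU.
  move=> y Yy; move: (Y01 _ Yy); rewrite /= !in_itv /= => y01.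
  have [yp|/ltW py] := leP y p; first by right; left; lra.
  have [yp|/ltW qy] := leP y (1 - p); first by left; split => //; lra.
  by right; right; lra.
apply: le_trans (measureU2 _ _ _) _ => //; first exact: measurableU.
apply: leeD => //; apply: le_trans (measureU2 _ _ _) _ => //.
rewrite [X in (X + _)%E]lebesgue_measure_segment; last exact: ltW.
by rewrite [X in (_ + X)%E]lebesgue_measure_segment -?EFinD ?lee_fin; lra.
Qed.

(** The approximate independence of the tilted family from sets of heights: its
sections have length at most [x0 / 2 + p / 4] at all heights, and at least
[x0 / 2 - p / 4] at heights in [p, 1 - p]. *)
Lemma lebesgue_measure2_tilteds (x0 : R) (Y : set R) v : 0 <= x0 <= 1 ->
  measurable Y -> Y `<=` `[0, 1] -> lam Y = v%:E ->
  exists2 w, lam2 (tilteds `&` (`[0, x0] `*` Y)) = w%:E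
           & `|w - x0 * v / 2| <= 2 * p.
Proof.
move=> /andP[x00 x01] mY Y01 vE; have p0 := mesh_gt0; have p1 := mesh_le1.
have v0 : 0 <= v by rewrite -lee_fin -vE.
have v1 : v <= 1.
  rewrite -lee_fin -vE; apply: (@le_trans _ _ (lam `[0, 1])).
    by apply: le_measure; rewrite ?inE.
  by rewrite lebesgue_measure_segment // subr0.
set S := tilteds `&` (`[0, x0] `*` Y).
have mS : measurable S.
  by apply: measurableI; [exact: measurable_tilteds | exact: measurableX].
have itv0 (c : R) : 0 <= c -> lam `[0, c] = c%:E.
  by move=> c0; rewrite lebesgue_measure_segment // subr0.
have secX (c y : R) (Y' : set R) : ysection (`[0, c] `*` Y') y =
    if y \in Y' then `[0, c]%classic else set0.
  by case: ifPn => yY; [rewrite in_ysectionX | rewrite notin_ysectionX].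
have ub : (lam2 S <= ((x0 / 2 + p / 4) * v)%:E)%E.
  have -> : ((x0 / 2 + p / 4) * v)%:E = lam2 (`[0, x0 / 2 + p / 4] `*` Y).
    by rewrite lebesgue_measure2_setX // vE itv0 // addr_ge0 // divr_ge0 // ltW.
  apply: le_lebesgue_measure2_ysection => //; first exact: measurableX.
  move=> y; rewrite /S ysection_tilteds // secX; case: ifP => // _.
  have [w [wE wu _]] := comb_measure_bounds ((y - 1) / p + 1) (n.+1 * n) p0 x00.
  rewrite wE itv0 ?lee_fin; first by rewrite subr0 in wu.
  by rewrite addr_ge0 // divr_ge0 // ltW.
have [v' v'E v'b] := lebesgue_measure_inner mY Y01 vE.
have lb : (((x0 / 2 - p / 4) * v')%:E <= lam2 S)%E.
  have v'0 : 0 <= v' by rewrite -lee_fin -v'E.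
  (* For [x0] below [p / 2] the comparison rectangle would have negative width,
     but then there is nothing to prove. *)
  have [c0|c0] := leP 0 (x0 / 2 - p / 4); last first.
    apply: (@le_trans _ _ 0%E); last exact: measure_ge0.
    by rewrite lee_fin; nra.
  have -> : ((x0 / 2 - p / 4) * v')%:E =
      lam2 (`[0, x0 / 2 - p / 4] `*` (Y `&` `[p, 1 - p])).
    by rewrite lebesgue_measure2_setX ?v'E ?itv0 //; apply: measurableI.
  apply: le_lebesgue_measure2_ysection => //.
    by apply: measurableX => //; apply: measurableI.
  move=> y; rewrite /S ysection_tilteds // secX.
  case: ifP; last by move=> _; rewrite measure0.
  rewrite inE => -[Yy]; rewrite /= in_itv /= => /andP[py yq].
  rewrite mem_set //.
  have [w [wE _ wl]] := comb_measure_bounds ((y - 1) / p + 1) (n.+1 * n) p0 x00.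
  rewrite wE itv0 // lee_fin; rewrite subr0 in wl; apply: wl.
    have : (y - 1) / p <= -1 by rewrite ler_pdivrMr //; lra.
    by lra.
  have -> : (n.+1 * n)%:R * p = n%:R.
    by rewrite mulnC natrM -mulrA mesh_mul mulr1.
  have : - n%:R <= (y - 1) / p by rewrite ler_pdivlMr // mulNr mesh_muln; lra.
  by lra.
have [w wE /andP[wl wu]] : exists2 w, lam2 S = w%:E
  & (x0 / 2 - p / 4) * v' <= w <= (x0 / 2 + p / 4) * v.
  by apply: ereal_between; rewrite lb ub.
by exists w => //; rewrite ler_norml; nra.
Qed.

(** Inclusion-exclusion.  The constant 5 leaves room for the two errors of
[2 * p] in the measures of the tilted family and of the intersection. *)
Lemma flats_tilteds_density (x0 y0 : R) (J := `[0, x0] `*` `[0, y0]) :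
  0 <= x0 <= 1 -> 0 <= y0 <= 1 ->
  [/\ lam2 J = (x0 * y0)%:E,
      exists2 u, lam2 ((flats `|` tilteds) `&` J) = u%:E
               & `|u - 3 / 4 * (x0 * y0)| <= 5 * p
    & exists2 u, (lam2 (flats `&` J) + lam2 (tilteds `&` J))%E = u%:E
               & `|u - x0 * y0| <= 5 * p].
Proof.
move=> x01 y01; have p0 := mesh_gt0.
have itv0 (c : R) : 0 <= c <= 1 -> lam `[0, c] = c%:E.
  by case/andP=> c0 _; rewrite lebesgue_measure_segment // subr0.
have mJ : measurable J by exact: measurableX.
have [v [vE fE vb]] := lebesgue_measure2_flats x01 y01.
have y0I : `[0, y0] `<=` `[0, 1] by move=> y; rewrite /= !in_itv /=; lra.
have mC := measurable_comb 0 (p ^+ 2) (n.+1 * n.+1).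
have [w1 w1E w1b] :=
  lebesgue_measure2_tilteds x01 (measurable_itv `[0, y0]) y0I (itv0 _ y01).
have [w2 w2E w2b] := lebesgue_measure2_tilteds x01
  (measurableI _ _ mC (measurable_itv `[0, y0]))
  (subset_trans (@subIsetr _ _ _) y0I) vE.
move: vb w1b w2b; rewrite !ler_norml => vb w1b w2b.
split.
- by rewrite lebesgue_measure2_setX // !itv0.
- exists (x0 * v + w1 - w2); last by rewrite ler_norml; nra.
  rewrite setIUl /lebesgue_measure2 measureUfinr.
  + rewrite EFinB EFinD -fE -w1E -w2E; congr (_ - lam2 _)%E.
    rewrite flats_setI; last by lra.
    by rewrite /J; apply/seteqP; split=> -[x y] /=; tauto.
  + by apply: measurableI => //; exact: measurable_flats.
  + by apply: measurableI => //; exact: measurable_tilteds.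
  + by rewrite [X in (X < _)%E]w1E ltry.
- exists (x0 * v + w1); last by rewrite ler_norml; nra.
  by rewrite EFinD -fE -w1E.
Qed.

End Families.

Theorem theorem2 (R : realType) (epsilon : R) (epsilon_gt0 : 0 < epsilon) :
  exists (S : nat) (b1 b2 delta : 'I_S -> R),
    [/\ (0 < S)%N,
        forall s, [/\ 0 < delta s, 0 <= b1 s <= 1 - delta s
                    & 0 <= b2 s <= 1 - delta s],
        [set 0] `*` `[epsilon, 1 - epsilon]
          `<=` \bigcup_s left_side (b1 s) (delta s)
      & forall (x0 y0 : R) (J : set (R * R)),
          0 <= x0 <= 1 -> 0 <= y0 <= 1 ->
          J = `[0, x0] `*` `[0, 1] \/ J = `[0, 1] `*` `[0, y0] ->
          (`| lebesgue_measure2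
                ((\bigcup_s parallelogram (b1 s) (b2 s) (delta s)) `&` J)
              - (3 / 4)%:E * lebesgue_measure2 J | < epsilon%:E)%E /\
          (`| \sum_(s < S) lebesgue_measure2
                (parallelogram (b1 s) (b2 s) (delta s) `&` J)
              - lebesgue_measure2 J | < epsilon%:E)%E].
Proof.
pose n := Num.truncn (5 / epsilon).
have n_eps : 5 * mesh R n < epsilon.
  by rewrite /mesh ltr_pdivrMr ?ltr0n // mulrC -ltr_pdivrMr // truncnS_gt.
set p := mesh R n in n_eps; pose q := p ^+ 2; pose d := q / 2.
pose N := (n.+1 * n.+1)%N; pose K := (n.+1 * n)%N.
have p0 : 0 < p := mesh_gt0 R n.
have p1 : p <= 1 := mesh_le1 R n.
have q0 : 0 < q by rewrite exprn_gt0.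
have d0 : 0 < d by rewrite divr_gt0.
have Nq : N%:R * q = 1 by rewrite natrM /q expr2 mulrACA mesh_mul mul1r.
have Kq : K%:R * q = 1 - p.
  by rewrite natrM /q expr2 mulrACA mesh_mul mul1r mesh_muln.
have step (a b : nat) : (a < b)%N -> a%:R * q + q <= b%:R * q.
  by move=> ab; rewrite -natrSM ler_pM2r // ler_nat.
have pos (a : nat) : 0 <= a%:R * q by rewrite mulr_ge0 // ltW.
pose bt (k : nat) := K%:R * q - k%:R * q - d.
pose b1 (s : 'I_(N + K)) :=
  match fintype.split s with inl i => i%:R * q | inr k => bt k end.
pose b2 (s : 'I_(N + K)) :=
  match fintype.split s with inl i => i%:R * q | inr k => bt k + p end.
exists (N + K)%N, b1, b2, (fun=> d).
have PA (i : 'I_N) :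
    parallelogram (b1 (lshift K i)) (b2 (lshift K i)) d = @flat R n i.
  by rewrite parallelogramE // /b1 /b2 (unsplitK (inl i)) subrr.
have PB (k : 'I_K) :
    parallelogram (b1 (rshift N k)) (b2 (rshift N k)) d = @tilted R n k.
  by rewrite parallelogramE // /b1 /b2 (unsplitK (inr k)) addrC addKr.
split.
- by [].
- move=> s; split=> //; rewrite /b1 /b2; case: (fintype.split s) => k.
  + by have := step _ _ (ltn_ord k); have := pos k; rewrite Nq /d; lra.
  + by have := step _ _ (ltn_ord k); have := pos k; rewrite /bt Kq /d; lra.
  + by have := step _ _ (ltn_ord k); have := pos k; rewrite Nq /d; lra.
  + by have := step _ _ (ltn_ord k); have := pos k; rewrite /bt Kq /d; lra.
- move=> [x y] /= [-> ]; rewrite in_itv /= => ye.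
  (* [k] is the cell of height [y]; its lower half starts a flat strip and its
     upper half a tilted one. *)
  pose k := Num.truncn (y / q).
  have yq : k%:R * q <= y < k%:R * q + q.
    rewrite -natrSM -ler_pdivlMr // -ltr_pdivrMr // ; apply: truncn_itv.
    by rewrite divr_ge0 // ?ltW //; lra.
  have lt_of (a b : nat) : a%:R * q < b%:R * q -> (a < b)%N.
    by rewrite ltr_pM2r // ltr_nat.
  have [yk|yk] := leP y (k%:R * q + d).
    have kN : (k < N)%N by apply: lt_of; lra.
    exists (lshift K (Ordinal kN)) => //.
    by rewrite /b1 (unsplitK (inl _)) /=; split=> //=; rewrite in_itv /=; lra.
  have kK : (k < K)%N by apply: lt_of; lra.
  (* The tilted strips are numbered downwards. *)
  have kK' : (K - k.+1 < K)%N by rewrite ltn_subrL (leq_ltn_trans _ kK).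
  exists (rshift N (Ordinal kK')) => //.
  rewrite /b1 (unsplitK (inr _)) /bt /= natrB // mulrBl natrSM.
  by split=> //=; rewrite in_itv /= /d; rewrite /d in yk; lra.
move=> x0 y0 J x01 y01 HJ.
have [a [b [a01 b01 JE]]] : exists a b : R,
    [/\ 0 <= a <= 1, 0 <= b <= 1 & J = `[0, a] `*` `[0, b]].
  by case: HJ => ->; [exists x0, 1 | exists 1, y0]; split=> //; lra.
have [JE' [u uE ub] [w wE wb]] := flats_tilteds_density n a01 b01.
rewrite -JE in JE' uE wE.
have mJ : measurable J by rewrite JE; exact: measurableX.
split.
- have -> : \bigcup_s parallelogram (b1 s) (b2 s) d = flats n `|` tilteds n.
    apply/seteqP; split=> z.
      move=> [s _]; case: (split_ordP s) => k ->; rewrite ?PA ?PB => zk.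
        by left; exists k.
      by right; exists k.
    by move=> [[k _ zk]|[k _ zk]]; [exists (lshift K k) | exists (rshift N k)];
      rewrite ?PA ?PB.
  by rewrite uE JE' -EFinM -EFinB /= lte_fin (le_lt_trans ub).
rewrite big_split_ord /=.
under eq_bigr do rewrite PA.
under [X in (_ + X - _)%E]eq_bigr do rewrite PB.
rewrite -!lebesgue_measure2_bigcup_setI //.
- by rewrite wE JE' -EFinB /= lte_fin (le_lt_trans wb).
- by move=> k; exact: measurable_strip.
- exact: trivIset_tilted.
- by move=> k; exact: measurable_strip.
- exact: trivIset_flat.
Qed.
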